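(* Let $n\in\mathbb N_0$, $q\in\mathbb C\setminus\{0\}$ with $|q|\neq1$, $z\in\mathbb C\setminus\{0\}$, and fix a square root $q^{1/2}$ of $q$. Then $$z^n\,{}_1\phi_1\left(q^{-2n};\ 0;\ q^2,\frac{q^{2}}{z^2}\right)=q^{-\frac{n^2}2}(-q;q)_n\;{}_3\phi_1\left(q^{-n},\,q^{\frac12}z,\,q^{\frac12}z^{-1};\ -q;\ q,-q^n\right),$$ and, provided $(q^{\frac12}z,q^{\frac12}z^{-1};q)_n\neq0$, both sides are also equal to $$(-1)^nq^{-\frac{n^2}2}(q^{\frac12}z,q^{\frac12}z^{-1};q)_n\;{}_3\phi_2\left(q^{-n},\,-q^{-n},\,0;\ q^{\frac12-n}z,\,q^{\frac12-n}z^{-1};\ q,q\right).$$ These expressions are invariant under the replacement $z\mapsto z^{-1}$.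
   Context: $(a;q)_n=\prod_{j=0}^{n-1}(1-aq^j)$, $(a_1,\dots,a_k;q)_n=\prod_i(a_i;q)_n$, and $${}_r\phi_s(a_1,\dots,a_r;b_1,\dots,b_s;q,z)=\sum_{k\ge0}\frac{(a_1,\dots,a_r;q)_k}{(q,b_1,\dots,b_s;q)_k}\left((-1)^kq^{\binom k2}\right)^{1+s-r}z^k ,$$ where the series terminates at $k=n$ if a numerator parameter equals the base to the power $-n$, $n\in\mathbb N_0$. The first series in the claim has base $q^2$, the others base $q$. Half-integer powers of $q$ are powers of the fixed $q^{1/2}$. *)

(* Defs.v *)
From mathcomp Require Import all_boot all_order all_algebra.
From mathcomp Require Export complex.
From mathcomp Require Import all_classical all_reals all_analysis.

Set Implicit Arguments.
Unset Strict Implicit.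
Unset Printing Implicit Defensive.

Import Order.TTheory GRing.Theory Num.Theory numFieldNormedType.Exports.

Local Open Scope ring_scope.

Section BasicHypergeometric.
Variable C : numFieldType.
Implicit Types (a q z : C) (s : seq C).

Definition qpoch a q (n : nat) : C := \prod_(j < n) (1 - a * q ^+ j).

Definition qpochs s q (n : nat) : C := \prod_(a <- s) qpoch a q n.

(* The exponent 1 + s - r may be negative, so this is an integer power. *)
Definition qhyp_term (num den : seq C) q z (k : nat) : C :=
  qpochs num q k / qpochs (q :: den) q k
  * ((-1) ^+ k * q ^+ 'C(k, 2)) ^ ((1 + size den)%:Z - (size num)%:Z)
  * z ^+ k.

(* Sum of the infinite series, as a limit of partial sums. If a numerator
   parameter is q ^- n, every term with k > n has a vanishing numerator, hence
   is 0 (also when its denominator vanishes, since x / 0 = 0), so the series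
   terminates at k = n. *)
Definition qhyp (num den : seq C) q z : C :=
  limn (series (qhyp_term num den q z) : nat -> C^o).

End BasicHypergeometric.

(* Main.v *)
Require Import Defs.
From mathcomp Require Import all_boot all_order all_algebra.
From mathcomp Require Import complex all_classical all_reals all_analysis.
From mathcomp Require Import ring zify.

Import Order.TTheory GRing.Theory Num.Theory numFieldNormedType.Exports.

Local Open Scope ring_scope.

(** The three sides are Laurent polynomials in [z], and two of them expand in
the same basis.

Write [p = q ^+ 2], [x = z + z^-1] and [s] for the chosen square root of [q].
Expressing [(p ^- n; p)_k] through Gaussian binomials ([qpoch_negn]) turns the
left side into
[\sum_k [n, k]_p p ^ (k (k - n)) z ^ (n - 2 k)], with [[n, k]_p] the Gaussian
binomial: this is the continuous q-Hermite polynomial in [x] in base [p^-1]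
([hermite], [qhyp_1phi1]). The 3phi1 becomes [s ^- (n ^ 2)] times a
combination ([askey], [qhyp_3phi1]) of the products
[(s z, s / z; q)_k = \prod_(j < k) (1 - s q ^ j x + q ^ (2 j + 1))], which are
polynomials in [x] of degree [k]. The 3phi2 is the same combination summed
backwards: its denominators are ratios of these products ([basis_rev]), so that
the index [k] of the 3phi2 matches the index [n - k] of the 3phi1
([qhyp_3phi2]).

It remains to identify the Hermite sum with the second expansion. Both sides
satisfy
[y_(n + 2) = x y_(n + 1) - (1 - p ^ (- n - 1)) y_n], [y_0 = 1], [y_1 = x]
([hermite_rec], [askey_rec]). Each recurrence is proved by creative
telescoping: applied to the summand, it gives a difference [G (k + 1) - G k]
with an explicit [G] vanishing at both ends ([zeilberger_rec]).

The second expansion depends on [z] only through the products above, which are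
visibly symmetric in [z] and [z^-1]; this gives the invariance of all three
expressions. The condition on the norm of [q] excludes roots of unity, so
that [(q; q)_k] and [(- q; q)_k] never vanish. *)

(** * Terminating series *)

Definition nonroot1 {C : numFieldType} (q : C) : Prop :=
  forall k, q ^+ k.+1 != 1.

(** The coefficient [1 / (q; q)_(n - k)], extended by 0 for [k > n] as is
natural for the reciprocal of a q-factorial. With this convention the relations
in [n] and [k] below hold unconditionally, so that summands outside the range
[k <= n] need no separate treatment. *)
Definition qfactV {C : numFieldType} (q : C) (n k : nat) : C :=
  if (k <= n)%N then (qpoch q q (n - k))^-1 else 0.

(** [(s z, s / z; q)_k], as a function of [z + z^-1] the Askey-Wilson type basis
of the polynomials. *)
Definition basis {C : numFieldType} (s z q : C) (k : nat) : C :=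
  qpochs [:: s * z; s * z^-1] q k.

Lemma qhyp_finite {C : numFieldType} (num den : seq C) (q z : C) (n : nat) :
  (forall k, (n < k)%N -> qhyp_term num den q z k = 0) ->
  qhyp num den q z = \sum_(k < n.+1) qhyp_term num den q z k.
Proof.
move=> term0; rewrite /qhyp; apply: (@lim_near_cst C^o (@norm_hausdorff C C^o)).
near=> m; rewrite /series /=.
have le_nm : (n.+1 <= m)%N by near: m; exact: nbhs_infty_ge.
rewrite (big_cat_nat _ le_nm) //=.
rewrite [X in _ + X]big_nat_cond [X in _ + X]big1 ?addr0 ?big_mkord // => i.
by rewrite andbT => /andP[lt_ni _]; exact: term0.
Unshelve. all: by end_near.
Qed.

Lemma qpochS {C : numFieldType} (a q : C) k :
  qpoch a q k.+1 = qpoch a q k * (1 - a * q ^+ k).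
Proof. by rewrite /qpoch big_ord_recr. Qed.

Lemma qpoch0 {C : numFieldType} (a q : C) : qpoch a q 0 = 1.
Proof. by rewrite /qpoch big_ord0. Qed.

Lemma qpochs_cons {C : numFieldType} (a : C) s q k :
  qpochs (a :: s) q k = qpoch a q k * qpochs s q k.
Proof. by rewrite /qpochs big_cons. Qed.

Lemma qpochs_nil {C : numFieldType} (q : C) k : qpochs [::] q k = 1.
Proof. by rewrite /qpochs big_nil. Qed.

Definition qpochsE := (@qpochs_cons, @qpochs_nil, @mulr1).

Lemma qpoch_0l {C : numFieldType} (q : C) k : qpoch 0 q k = 1.
Proof. by rewrite /qpoch big1 // => i _; rewrite mul0r subr0. Qed.

Lemma qpoch_neq0 {C : numFieldType} (q : C) k : nonroot1 q -> qpoch q q k != 0.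
Proof.
move=> hq; rewrite /qpoch prodf_seq_neq0; apply/allP => i _ /=.
by rewrite -exprS subr_eq0 eq_sym hq.
Qed.

Lemma qpoch_sqr {C : numFieldType} (a q : C) k :
  qpoch a q k * qpoch (- a) q k = qpoch (a ^+ 2) (q ^+ 2) k.
Proof.
rewrite /qpoch -big_split /=; apply: eq_bigr => i _.
rewrite -exprM mulnC exprM; ring.
Qed.

Lemma nonroot1_sqr {C : numFieldType} (q : C) : nonroot1 q -> nonroot1 (q ^+ 2).
Proof. by move=> hq k; rewrite -exprM mulnS; exact: hq. Qed.

Lemma nonroot1_norm {R : realType} (q : R[i]) : `|q| != 1 -> nonroot1 q.
Proof.
move=> hq k; apply: contra_neq hq => qk1.
apply/eqP; rewrite -(@pexpr_eq1 _ _ k.+1) //; apply/eqP.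
by rewrite -normrX qk1 normr1.
Qed.

(** For [k = n] the left side is 0 by convention, and the factor on the right
vanishes as well. *)
Lemma qfactVS {C : numFieldType} (q : C) n k :
  q != 0 -> nonroot1 q ->
  qfactV q n k.+1 = (1 - q ^+ n / q ^+ k) * qfactV q n k.
Proof.
move=> q0 hq; rewrite /qfactV; case: (ltngtP k n) => [lt_kn|lt_nk|->].
- have -> : (n - k = (n - k.+1).+1)%N by lia.
  have -> : q ^+ n = q ^+ (n - k.+1) * q * q ^+ k.
    by rewrite -exprSr -exprD; congr (_ ^+ _); lia.
  rewrite qpochS; have := qpoch_neq0 q (n - k.+1) hq.
  have := hq (n - k.+1)%N; rewrite exprSr eq_sym -subr_eq0 => h1 h2.
  by field; rewrite expf_neq0 // h2 mulrC h1.
- by rewrite mulr0.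
- by rewrite divff ?subrr ?mul0r // expf_neq0.
Qed.

Lemma qfactVSS {C : numFieldType} (q : C) n k :
  qfactV q n.+1 k.+1 = qfactV q n k.
Proof. by rewrite /qfactV ltnS subSS. Qed.

Lemma qfactV_eq0 {C : numFieldType} (q : C) n k : (n < k)%N -> qfactV q n k = 0.
Proof. by rewrite /qfactV ltnNge => /negbTE ->. Qed.

(** Used to express all the summands of a recurrence in [n] through the one
with the largest [n], after which they can be compared as rational
functions. *)
Lemma qfactV_lift {C : numFieldType} (q : C) n k :
  q != 0 -> nonroot1 q ->
  qfactV q n k = (1 - q ^+ n.+1 / q ^+ k) * qfactV q n.+1 k.
Proof. by move=> q0 hq; rewrite -qfactVS // qfactVSS. Qed.

(** [(q ^- n; q)_k] contains a Gaussian binomial: the factor [1 - q ^ (j - n)]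
is [- q ^ (j - n)] times [1 - q ^ (n - j)]. It vanishes for [k > n], which
is what terminates the three series. *)
Lemma qpoch_negn {C : numFieldType} (q : C) n k :
  q != 0 -> nonroot1 q ->
  qpoch (q ^- n) q k =
    (-1) ^+ k * q ^+ 'C(k, 2) / q ^+ (n * k) * qpoch q q n * qfactV q n k.
Proof.
move=> q0 hq; elim: k => [|k IHk].
  rewrite qpoch0 muln0 /qfactV /= subn0; have := qpoch_neq0 q n hq => h.
  by rewrite !expr0; field.
rewrite qpochS IHk qfactVS // mulnS exprD binS bin1 exprD exprSr.
by field; rewrite !expf_neq0.
Qed.

(** * Two sums with the same recurrence *)

(** Creative telescoping: [G] is the certificate, and the three summands extend
by 0 to the common range [k < n + 3]. *)
Lemma zeilberger_rec {C : numFieldType} (F2 F1 F0 G : nat -> C) (a b : C) n :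
  (forall k, F2 k - a * F1 k + b * F0 k = G k.+1 - G k) ->
  G 0%N = 0 -> G n.+3 = 0 ->
  F1 n.+2 = 0 -> F0 n.+1 = 0 -> F0 n.+2 = 0 ->
  \sum_(k < n.+3) F2 k =
  a * \sum_(k < n.+2) F1 k - b * \sum_(k < n.+1) F0 k.
Proof.
move=> cert G0 Gn F1n F0n F0n'.
have := telescope_sumr G (leq0n n.+3); rewrite G0 Gn subrr big_mkord.
under eq_bigr do rewrite -cert.
rewrite big_split /= sumrB -!mulr_sumr => h.
have e1 : \sum_(k < n.+3) F1 k = \sum_(k < n.+2) F1 k.
  by rewrite big_ord_recr /= F1n addr0.
have e0 : \sum_(k < n.+3) F0 k = \sum_(k < n.+1) F0 k.
  by rewrite !big_ord_recr /= F0n F0n' !addr0.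
rewrite -e1 -e0; apply/eqP; rewrite -subr_eq0 -[X in _ == X]h; apply/eqP.
by ring.
Qed.

(** The exponent [k (k - n)] of [p] is nonpositive, whence the quotient;
likewise for [z ^ (n - 2 k)]. *)
Definition hermite_term {C : numFieldType} (p z : C) (n k : nat) : C :=
  qpoch p p n / qpoch p p k * qfactV p n k * (p ^+ (k * k) / p ^+ (n * k))
  * (z ^+ n / (z ^+ 2) ^+ k).

Lemma qfactV0 {C : numFieldType} (q : C) n :
  qfactV q n 0 = (qpoch q q n)^-1.
Proof. by rewrite /qfactV subn0. Qed.

Lemma hermite_term0 {C : numFieldType} (p z : C) n :
  nonroot1 p -> hermite_term p z n 0 = z ^+ n.
Proof.
move=> hp; have h := qpoch_neq0 p n hp.
by rewrite /hermite_term qfactV0 qpoch0 !muln0 !expr0; field.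
Qed.

Definition hermite {C : numFieldType} (p z : C) (n : nat) : C :=
  \sum_(k < n.+1) hermite_term p z n k.

(** [(p; p)_n / (p; p)_k / (q; q)_(n - k)], with [p = q ^+ 2], is the Gaussian
binomial [[n, k]_q] times [(- q; q)_n / (- q; q)_k]. *)
Definition askey_term {C : numFieldType} (s z q : C) (n k : nat) : C :=
  (-1) ^+ k * (qpoch (q ^+ 2) (q ^+ 2) n / qpoch (q ^+ 2) (q ^+ 2) k)
  * qfactV q n k * basis s z q k.

Definition askey {C : numFieldType} (s z q : C) (n : nat) : C :=
  \sum_(k < n.+1) askey_term s z q n k.

Lemma basisS {C : numFieldType} (s z q : C) k : z != 0 -> s ^+ 2 = q ->
  basis s z q k.+1 =
  basis s z q k * (1 - s * q ^+ k * (z + z^-1) + q * q ^+ k * q ^+ k).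
Proof.
by move=> z0 <-; rewrite /basis !qpochsE !qpochS; field.
Qed.

(** The recurrence applied to the summand of index [k] yields monomials in [z]
of exponents [n + 2 - 2 k] and [n - 2 k]. The certificate [G k] is the opposite
of the sum of the former; that the latter sum to [G (k + 1)] is the recurrence
for the coefficients. *)
Lemma hermite_rec {C : numFieldType} (p z : C) n :
  p != 0 -> nonroot1 p -> z != 0 ->
  hermite p z n.+2 = (z + z^-1) * hermite p z n.+1
    - (1 - p ^- n.+1) * hermite p z n.
Proof.
move=> p0 hp z0; rewrite /hermite.
pose G k := hermite_term p z n.+1 k * z - hermite_term p z n.+2 k.
apply: (@zeilberger_rec _ _ _ _ G).
- move=> k; rewrite /G /hermite_term qfactVSS.
  rewrite (qfactV_lift _ n.+1 k) // (qfactV_lift _ n k) //.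
  rewrite (qfactV_lift _ n.+1 k) // qfactVS //.
  have h1 := qpoch_neq0 p k hp; rewrite !qpochS.
  have := hp k; rewrite exprS eq_sym -subr_eq0 => h2.
  have -> : (k.+1 * k.+1 = k * k + k + k + 1)%N by lia.
  have -> : (n.+2 * k = n * k + k + k)%N by lia.
  have -> : (n.+1 * k = n * k + k)%N by lia.
  have -> : (n.+2 * k.+1 = n * k + k + k + n + 2)%N by lia.
  have -> : (n.+1 * k.+1 = n * k + k + n + 1)%N by lia.
  rewrite !exprD !exprS !expr0.
  by field; rewrite h1 h2 p0 z0 !expf_neq0 ?mulf_neq0 ?oner_neq0.
- by rewrite /G !hermite_term0 // -exprSr subrr.
- by rewrite /G /hermite_term !qfactV_eq0 // !(mulr0, mul0r) subrr.
- by rewrite /hermite_term qfactV_eq0 // !(mulr0, mul0r).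
- by rewrite /hermite_term qfactV_eq0 // !(mulr0, mul0r).
- by rewrite /hermite_term qfactV_eq0 // !(mulr0, mul0r).
Qed.

(** This is the recurrence of [hermite_rec] rescaled by the factors
[s ^- (n ^ 2)]. Multiplication by [x = z + z^-1] is bidiagonal on the basis
[e_k = basis s z q k], namely
[s q ^ k x e_k = (1 + q ^ (2 k + 1)) e_k - e_(k + 1)]. The certificate
[G (k + 1)] is the contribution of [e_(k + 1)] here, and the terms in [e_k] add
up to [- G k]. The factor [1 - (q ^+ 2) ^+ k] in [G] comes from writing
[1 / (q ^+ 2; q ^+ 2)_(k - 1)] with the index [k]. *)
Lemma askey_rec {C : numFieldType} (s z q : C) n :
  q != 0 -> nonroot1 q -> z != 0 -> s ^+ 2 = q ->
  askey s z q n.+2 = s * q ^+ n.+1 * (z + z^-1) * askey s z q n.+1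
    - ((q ^+ 2) ^+ n.+1 - 1) * askey s z q n.
Proof.
move=> q0 hq z0 hs; rewrite /askey.
pose G k := - ((-1) ^+ k * q ^+ n.+2 / q ^+ k * (1 - (q ^+ 2) ^+ k)
  * (qpoch (q ^+ 2) (q ^+ 2) n.+1 / qpoch (q ^+ 2) (q ^+ 2) k)
  * qfactV q n.+2 k * basis s z q k).
apply: (@zeilberger_rec _ _ _ _ G).
- move=> k; rewrite /G /askey_term basisS // qfactVS //.
  rewrite (qfactV_lift _ n k) // (qfactV_lift _ n.+1 k) //.
  have h1 := qpoch_neq0 (q ^+ 2) k (nonroot1_sqr _ hq); rewrite !qpochS.
  have := nonroot1_sqr _ hq k; rewrite exprS eq_sym -subr_eq0 => h2.
  move: h2; rewrite -!exprM !(mulnC 2%N) !exprM => h2.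
  rewrite !exprS !expr0 !mulr1 in h1 h2 *.
  by field; rewrite h1 h2 z0 !expf_neq0.
- by rewrite /G !expr0 subrr !(mulr0, mul0r) oppr0.
- by rewrite /G qfactV_eq0 // !(mulr0, mul0r) oppr0.
- by rewrite /askey_term qfactV_eq0 // !(mulr0, mul0r).
- by rewrite /askey_term qfactV_eq0 // !(mulr0, mul0r).
- by rewrite /askey_term qfactV_eq0 // !(mulr0, mul0r).
Qed.

Lemma hermite_askey {C : numFieldType} (s z q : C) n :
  q != 0 -> nonroot1 q -> z != 0 -> s ^+ 2 = q ->
  hermite (q ^+ 2) z n = s ^- (n ^ 2) * askey s z q n.
Proof.
move=> q0 hq z0 hs; have hp := nonroot1_sqr q hq.
have s0 : s != 0 by apply: contra_neq q0 => s0; rewrite -hs s0 expr0n.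
suff: hermite (q ^+ 2) z n = s ^- (n ^ 2) * askey s z q n /\
  hermite (q ^+ 2) z n.+1 = s ^- (n.+1 ^ 2) * askey s z q n.+1 by case.
have basis0 : basis s z q 0 = 1 by rewrite /basis !qpochsE !qpoch0 mulr1.
have q1 : 1 - q != 0 by rewrite subr_eq0 eq_sym (hq 0%N).
elim: n => [|m [IH0 IH1]].
  rewrite /hermite /askey !big_ord_recr !big_ord0 /= !hermite_term0 //.
  rewrite /askey_term basisS // basis0 /hermite_term /qfactV /=.
  rewrite !(qpochS, qpoch0).
  have qq1 : 1 - q ^+ 2 != 0 by rewrite subr_eq0 eq_sym (hq 1%N).
  by split; field; rewrite // z0 qq1 q1 s0 q0.
split=> //; rewrite hermite_rec ?expf_neq0 // askey_rec // IH0 IH1.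
have -> : (m.+2 ^ 2 = m ^ 2 + (m + m) + (m + m) + 4)%N by lia.
have -> : (m.+1 ^ 2 = m ^ 2 + (m + m) + 1)%N by lia.
have -> : (q ^+ 2) ^+ m.+1 = s ^+ m ^+ 4 * s ^+ 4.
  by rewrite -hs -!exprM -exprD; congr (_ ^+ _); lia.
have -> : q ^+ m.+1 = s ^+ m ^+ 2 * s ^+ 2.
  by rewrite -hs -!exprM -exprD; congr (_ ^+ _); lia.
rewrite !exprD expr1.
by field; rewrite z0 s0 !expf_neq0.
Qed.

(** * The three hypergeometric series *)

Lemma qhyp_1phi1 {C : numFieldType} (p z : C) n :
  p != 0 -> nonroot1 p -> z != 0 ->
  z ^+ n * qhyp [:: p ^- n] [:: 0] p (p / z ^+ 2) = hermite p z n.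
Proof.
move=> p0 hp z0; rewrite (qhyp_finite _ _ _ _ n) => [|k lt_nk].
  rewrite mulr_sumr; apply: eq_bigr => k _.
  rewrite /qhyp_term !qpochsE qpoch_0l qpoch_negn //= mulr1.
  rewrite (_ : (1 + 1)%:Z - 1%:Z = 1) // expr1z /hermite_term.
  have -> : p ^+ (k * k) = p ^+ 'C(k, 2) * p ^+ 'C(k, 2) * p ^+ k.
    rewrite -!exprD; congr (_ ^+ _).
    by case: k => k _ /=; elim: k => // k IHk; rewrite binS bin1; lia.
  have h1 := qpoch_neq0 p k hp.
  rewrite expr_div_n.
  (* The sign occurs squared, which splitting on the parity lets [field] see. *)
  rewrite -(signr_odd _ k).
  by case: (odd k); rewrite ?expr0 ?expr1; field; rewrite h1 !expf_neq0.
by rewrite /qhyp_term !qpochsE qpoch_negn // qfactV_eq0 // !(mulr0, mul0r).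
Qed.

Lemma qhyp_3phi1 {C : numFieldType} (s z q : C) n :
  q != 0 -> nonroot1 q ->
  qpoch (- q) q n * qhyp [:: q ^- n; s * z; s * z^-1] [:: - q] q (- q ^+ n)
  = askey s z q n.
Proof.
move=> q0 hq; have hp := nonroot1_sqr q hq.
rewrite (qhyp_finite _ _ _ _ n) => [|k lt_nk].
  rewrite mulr_sumr; apply: eq_bigr => k _.
  rewrite /qhyp_term (qpochs_cons (q ^- n)) -/(basis s z q k) !qpochsE.
  rewrite qpoch_negn //=.
  rewrite (_ : (1 + 1)%:Z - 3%:Z = - 1%:Z) // exprN1 /askey_term.
  have h := qpoch_neq0 (q ^+ 2) k hp.
  rewrite -!qpoch_sqr in h *.
  move: h; rewrite mulf_eq0 negb_or => /andP[h1 h2].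
  rewrite [(- q ^+ n) ^+ k]exprNn -exprM.
  by field; rewrite h1 h2 !expf_neq0 ?oppr_eq0 ?oner_neq0.
by rewrite /qhyp_term !qpochsE qpoch_negn // qfactV_eq0 // !(mulr0, mul0r).
Qed.

(** Each factor of the first product is a factor of the second up to a power of
[q]: [1 - s q ^ (j - n) x + q ^ (2 (j - n) + 1)] is [q ^ (2 (j - n) + 1)] times
[1 - s q ^ i x + q ^ (2 i + 1)] with [i = n - 1 - j]. *)
Lemma basis_rev {C : numFieldType} (s z q : C) n k :
  q != 0 -> z != 0 -> s ^+ 2 = q -> (k <= n)%N ->
  qpochs [:: s * q ^- n * z; s * q ^- n * z^-1] q k * basis s z q (n - k)
    * q ^+ (n ^ 2) = basis s z q n * q ^+ ((n - k) ^ 2).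
Proof.
move=> q0 z0 hs; elim: k => [_|k IHk lt_kn].
  by rewrite !qpochsE !qpoch0 !mul1r subn0.
have := IHk (ltnW lt_kn); rewrite !qpochsE !qpochS.
have -> : (n - k = (n - k.+1).+1)%N by lia.
have -> : q ^+ n = q ^+ (n - k.+1) * q * q ^+ k.
  by rewrite -exprSr -exprD; congr (_ ^+ _); lia.
move: (n - k.+1)%N => m; rewrite basisS //.
have -> : (m.+1 ^ 2 = m ^ 2 + m + m + 1)%N by lia.
rewrite !exprD expr1 => IH.
have qm0 : q ^+ m * q ^+ m * q != 0 by rewrite !mulf_neq0 ?expf_neq0.
apply: (mulIf qm0); rewrite -[RHS]mulrA.
have -> : q ^+ (m ^ 2) * (q ^+ m * q ^+ m * q)
    = q ^+ (m ^ 2) * q ^+ m * q ^+ m * q.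
  by rewrite !mulrA.
rewrite -IH.
have [qm qk] : q ^+ m != 0 /\ q ^+ k != 0 by rewrite !expf_neq0.
move: (q ^+ k) (q ^+ m) (q ^+ (n ^ 2)) qm qk => qk qm qn qm0' qk0.
move: (basis s z q m) (qpoch _ q k) (qpoch _ q k) => F A B.
rewrite -hs in q0 *; move: q0; rewrite sqrf_eq0 => s0.
by field; rewrite z0 s0 qm0' qk0.
Qed.

(** By [basis_rev] the denominators turn [basis s z q n] into
[basis s z q (n - k)], hence the reversal of the sum; the numerator is
[(q ^- (2 n); q ^+ 2)_k] and all powers of [q] cancel. *)
Lemma qhyp_3phi2 {C : numFieldType} (s z q : C) n :
  q != 0 -> nonroot1 q -> z != 0 -> s ^+ 2 = q -> basis s z q n != 0 ->
  (-1) ^+ n * basis s z q n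
    * qhyp [:: q ^- n; - q ^- n; 0]
           [:: s * q ^- n * z; s * q ^- n * z^-1] q q
  = askey s z q n.
Proof.
move=> q0 hq z0 hs bn0; have hp := nonroot1_sqr q hq.
have p0 : q ^+ 2 != 0 by rewrite expf_neq0.
have numE k : qpochs [:: q ^- n; - q ^- n; 0] q k
    = qpoch ((q ^+ 2) ^- n) (q ^+ 2) k.
  rewrite !qpochsE qpoch_0l mulr1 qpoch_sqr.
  by rewrite exprVn -!exprM mulnC.
rewrite (qhyp_finite _ _ _ _ n) => [|k lt_nk]; last first.
  by rewrite /qhyp_term numE qpoch_negn // qfactV_eq0 // !(mulr0, mul0r).
(* From here on [m] is the index of the expansion and [k = n - m] that of the
   hypergeometric series. *)
rewrite mulr_sumr (reindex_inj rev_ord_inj) /=; apply: eq_bigr => -[m /=].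
rewrite ltnS subSS => le_mn _.
have [k nE] : exists k, n = (m + k)%N by exists (n - m)%N; lia.
have le_kn : (k <= n)%N by lia.
have := basis_rev s z q n k q0 z0 hs le_kn.
have -> : (n - m = k)%N by lia.
have -> : (n - k = m)%N by lia.
rewrite /qhyp_term numE qpochs_cons qpoch_negn //.
rewrite (_ : (1 + 2)%:Z - 3%:Z = 0) // expr0z /askey_term /qfactV le_mn le_kn.
have -> : (n - m = k)%N by lia.
have -> : (n - k = m)%N by lia.
set D := qpochs _ q k => rev.
have qn0 j : q ^+ j != 0 by rewrite expf_neq0.
have : D * basis s z q m != 0.
  have := mulf_neq0 bn0 (qn0 (m ^ 2)%N).
  by rewrite -rev mulf_eq0 negb_or => /andP[].
rewrite mulf_eq0 negb_or => /andP[D0 bm0].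
have h1 := qpoch_neq0 q k hq; have h2 := qpoch_neq0 (q ^+ 2) m hp.
have bnE : basis s z q n = D * basis s z q m * q ^+ (n ^ 2) / q ^+ (m ^ 2).
  by rewrite rev mulfK.
(* The exponents balance because [k ^ 2 + n ^ 2 = 2 n k + m ^ 2]. *)
have powE : (q ^+ 2) ^+ 'C(k, 2) * q ^+ k * q ^+ (n ^ 2)
  = (q ^+ 2) ^+ (n * k) * q ^+ (m ^ 2).
  rewrite -!exprM -!exprD; congr (_ ^+ _).
  suff : (2 * 'C(k, 2) + k = k * k)%N by nia.
  by elim: (k) => // j IHj; rewrite binS bin1; lia.
have -> : (-1) ^+ n = (-1) ^+ m * (-1) ^+ k :> C by rewrite -exprD nE.
have -> : (q ^+ 2) ^+ 'C(k, 2)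
    = (q ^+ 2) ^+ (n * k) * q ^+ (m ^ 2) / (q ^+ k * q ^+ (n ^ 2)).
  by rewrite -powE -(mulrA _ (q ^+ k)) mulfK // mulf_neq0.
have pnk0 : (q ^+ 2) ^+ (n * k) != 0 by rewrite expf_neq0.
rewrite bnE; move: (qpoch _ (q ^+ 2) m) (qpoch _ (q ^+ 2) n) h2 => pm pn h2.
rewrite -(signr_odd _ k) -(signr_odd _ m).
move: (q ^+ 2 ^+ (n * k)) pnk0 => pnk pnk0.
by case: (odd k); case: (odd m); rewrite ?expr0 ?expr1; field;
   rewrite h1 h2 D0 pnk0 !qn0.
Qed.

Lemma basis_inv {C : numFieldType} (s z q : C) k :
  basis s z^-1 q k = basis s z q k.
Proof. by rewrite /basis invrK !qpochsE mulrC. Qed.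

Lemma askey_inv {C : numFieldType} (s z q : C) n :
  askey s z^-1 q n = askey s z q n.
Proof. by apply: eq_bigr => k _; rewrite /askey_term basis_inv. Qed.

Theorem theorem6p53 (R : realType) (n : nat) (q sq z : R[i])
    (hq0 : q != 0) (hq1 : `|q| != 1) (hz : z != 0) (hsq : sq ^+ 2 = q) :
  let E1 (w : R[i]) : R[i] :=
    w ^+ n * qhyp [:: (q ^+ 2) ^- n] [:: 0] (q ^+ 2) (q ^+ 2 / w ^+ 2) in
  let E2 (w : R[i]) : R[i] :=
    sq ^- (n ^ 2) * qpoch (- q) q n
    * qhyp [:: q ^- n; sq * w; sq * w^-1] [:: - q] q (- q ^+ n) in
  let E3 (w : R[i]) : R[i] :=
    (-1) ^+ n * sq ^- (n ^ 2) * qpochs [:: sq * w; sq * w^-1] q n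
    * qhyp [:: q ^- n; - q ^- n; 0]
           [:: sq * q ^- n * w; sq * q ^- n * w^-1] q q in
  [/\ E1 z = E2 z,
      E1 z^-1 = E1 z,
      E2 z^-1 = E2 z
    & qpochs [:: sq * z; sq * z^-1] q n != 0 ->
      [/\ E1 z = E3 z, E2 z = E3 z & E3 z^-1 = E3 z]].
Proof.
move=> E1 E2 E3; have hq := nonroot1_norm q hq1.
have hzV : z^-1 != 0 by rewrite invr_eq0.
have E1E w : w != 0 -> E1 w = sq ^- (n ^ 2) * askey sq w q n.
  move=> w0; rewrite /E1 -(hermite_askey sq w q n hq0 hq w0 hsq).
  exact: (qhyp_1phi1 (q ^+ 2) w n (expf_neq0 2 hq0) (nonroot1_sqr q hq) w0).
have E2E w : E2 w = sq ^- (n ^ 2) * askey sq w q n.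
  by rewrite /E2 -mulrA qhyp_3phi1.
have E3E w : w != 0 -> basis sq w q n != 0 ->
    E3 w = sq ^- (n ^ 2) * askey sq w q n.
  move=> w0 bw0; rewrite /E3 -(qhyp_3phi2 _ _ _ _ hq0 hq w0 hsq bw0).
  by rewrite /basis [(-1) ^+ n * _]mulrC !mulrA.
clearbody E1 E2 E3; split=> [|||bz0].
- by rewrite E1E // E2E.
- by rewrite !E1E // askey_inv.
- by rewrite !E2E askey_inv.
have bzV0 : basis sq z^-1 q n != 0 by rewrite basis_inv.
split.
- by rewrite E1E // E3E.
- by rewrite E2E E3E.
- by rewrite !E3E // askey_inv.
Qed.
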